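(* Let $S\subseteq\Sigma^c$ be a set of $n$ keys, let $p\subseteq[c]\times\Sigma$ be a generalized key, and let $t\ge1$. Then the number of $2t$-tuples $(x_1,\dots,x_{2t})\in S^{2t}$ such that $\Delta_{i\in[2t]}x_i=p$ is at most $((2t-1)!!)^c\,n^t$.
   Context: Each key $x=x_1\cdots x_c\in\Sigma^c$ is identified with its set of position characters $\{(1,x_1),\dots,(c,x_c)\}\subseteq[c]\times\Sigma$. A generalized key is any subset of $[c]\times\Sigma$. $\Delta_{i}x_i$ denotes the symmetric difference of the sets $x_i$, i.e. the set of position characters occurring an odd number of times among $x_1,\dots,x_{2t}$. $(2t-1)!!=(2t-1)(2t-3)\cdots1$. *)

(* Defs.v *)
From mathcomp Require Import all_boot.
From mathcomp Require Import boolp classical_sets functions cardinality.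

Set Implicit Arguments.
Unset Strict Implicit.
Unset Printing Implicit Defensive.

Local Open Scope classical_set_scope.

Fixpoint double_factorial (n : nat) : nat :=
  if n is m.+2 then n * double_factorial m else 1.

Notation "n `!!" := (double_factorial n) (at level 2, format "n `!!") : nat_scope.

Section Keys.
Variables (Sigma : Type) (c : nat).

Definition key := c.-tuple Sigma.

Definition generalized_key := set ('I_c * Sigma).

Definition position_characters (x : key) : generalized_key :=
  [set (i, tnth x i) | i in [set: 'I_c]].

Definition symdiff_keys (m : nat) (x : m.-tuple key) : generalized_key :=
  \big[setY/set0]_(i < m) position_characters (tnth x i).

Lemma symdiff_keysE (m : nat) (x : m.-tuple key) :
  symdiff_keys x =
  [set a | odd #|[set i | `[< position_characters (tnth x i) a >]]%SET| ].
Proof.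
apply/seteqP; rewrite /symdiff_keys.
suff H a : ((\big[setY/set0]_(i < m) position_characters (tnth x i)) a) <->
  odd (\sum_(i < m) `[< position_characters (tnth x i) a >]).
  have E a : #|[set i | `[< position_characters (tnth x i) a >]]%SET| =
      \sum_(i < m) `[< position_characters (tnth x i) a >].
    rewrite -sum1_card (eq_bigl (fun i => `[< position_characters (tnth x i) a >])).
      by rewrite big_mkcond; apply: eq_bigr => i _; case: ifP.
    by move=> i; rewrite inE.
  by split=> a /=; rewrite E => /H.
elim/big_rec2: _ => //= i n A _ IH.
have T : is_true true by [].
have F : is_true false -> False by [].
by rewrite oddD oddb /=; case: asboolP => h; case: (odd n) IH => /= IH; tauto.
Qed.

End Keys.

(* Main.v *)
(** For sets [A_1, ..., A_2t] of keys, with the letters of odd multiplicity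
    prescribed at each of [c] positions, the number of admissible tuples is at
    most [((2t-1)!!)^c * prod_i sqrt |A_i|]; this is proved by induction on the
    number of positions.  Splitting each [A_i] according to its letter at one
    position reduces the inductive step to a weighted bound at one position:
    the sum of [w_1 y_1 * ... * w_2t y_2t] over all words [y] whose letters of
    odd multiplicity form [q] is at most [(2t-1)!! * prod_i ||w_i||_2].  There
    one fixes a permutation [f] without fixed points on [q] and equal to the
    identity outside [q]; the first letter [b] of such a word forces [f b] to
    occur at one of the [2t-1] other places [k], and Cauchy-Schwarz bounds the
    sum over [b] of [w_1 b * w_k (f b)] by [||w_1||_2 * ||w_k||_2]. *)
Require Import Defs.
From mathcomp Require Import all_boot all_order all_algebra.
From mathcomp Require Import ring realalg.
From mathcomp Require Import boolp classical_sets functions cardinality.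

Set Implicit Arguments.
Unset Strict Implicit.
Unset Printing Implicit Defensive.

Import Order.TTheory GRing.Theory Num.Theory.

(** * Letters of odd multiplicity in a word *)

Section Parity.
Variable Y : finType.
Implicit Types (q : {set Y}) (s : seq Y).

Definition toggle q a : {set Y} := [set x | (x == a) (+) (x \in q)]%SET.

Definition parity s : {set Y} := [set x | odd (count_mem x s)]%SET.

Lemma toggleK q a : toggle (toggle q a) a = q.
Proof. by apply/setP => x; rewrite !inE addbA addbb. Qed.

Lemma toggleC q a b : toggle (toggle q a) b = toggle (toggle q b) a.
Proof. by apply/setP => x; rewrite !inE addbCA. Qed.

Lemma odd_card_toggle q a : odd #|toggle q a| = ~~ odd #|q|.
Proof.
have [aq | aq] := boolP (a \in q).
  have -> : toggle q a = (q :\ a)%SET.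
    by apply/setP => x; rewrite !inE; case: eqVneq => // ->; rewrite aq.
  by rewrite [in RHS](cardsD1 a) aq /= negbK.
have -> : toggle q a = (a |: q)%SET.
  apply/setP => x; rewrite !inE.
  by case: eqVneq => // ->; rewrite (negbTE aq).
by rewrite cardsU1 aq.
Qed.

Lemma parity_nil : parity [::] = finset.set0.
Proof. by apply/setP => x; rewrite !inE. Qed.

Lemma parity_cons a s : parity (a :: s) = toggle (parity s) a.
Proof. by apply/setP => x; rewrite !inE /= oddD oddb eq_sym. Qed.

(* For [b] outside [q] this forces [f b = b]; on [q], any cyclic permutation works. *)
Lemma exists_toggle_matching q :
  ~~ odd #|q| -> exists2 f : Y -> Y, injective f & forall b, f b \in toggle q b.
Proof.
move=> oq; have Uq := enum_uniq (mem q).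
exists (next (enum q)); first exact: can_inj (prev_next Uq).
move=> b; have [bq | bq] := boolP (b \in q); last first.
  by rewrite next_nth mem_enum (negbTE bq) inE eqxx (negbTE bq).
rewrite inE -[_ \in q]mem_enum mem_next mem_enum bq addbT.
have sq : size (enum q) = #|q| by rewrite cardE.
move: oq; rewrite -sq -mem_enum in bq *.
(* With [b] rotated to the front, its successor is the second letter; evenness excludes a singleton,
   and [uniq] makes the two letters differ. *)
case/rot_to: bq => i s Es; rewrite -(next_rot i Uq) -(size_rot i).
move: Uq; rewrite -(rot_uniq i) Es.
case: s {Es} => // a s /= /andP[+ _] _.
by rewrite inE negb_or eqxx eq_sym => /andP[].
Qed.

End Parity.

Section ParitySums.
Local Open Scope ring_scope.
Variable R : rcfType.

Definition norm2 (Y : finType) (f : Y -> R) : R := Num.sqrt (\sum_y f y ^+ 2).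

(** * The weighted bound at one position *)

Section OneCoordinate.
Variable Y : finType.
Implicit Types (u v : Y -> R) (q : {set Y}) (w : nat -> Y -> R).

Lemma sum_mul_norm2 u v : \sum_y u y * v y <= norm2 u * norm2 v.
Proof.
have u0 : 0 <= \sum_y u y ^+ 2 by apply: sumr_ge0 => y _; exact: sqr_ge0.
rewrite /norm2 -sqrtrM //; apply: le_trans (ler_norm _) _.
rewrite -sqrtr_sqr ler_sqrt; last first.
  by apply: mulr_ge0 => //; apply: sumr_ge0 => y _; exact: sqr_ge0.
(* Lagrange's identity: this sum of squares is twice the difference of the two squared sides. *)
have : 0 <= \sum_x \sum_y (u x * v y - u y * v x) ^+ 2.
  by apply: sumr_ge0 => x _; apply: sumr_ge0 => y _; exact: sqr_ge0.
set S1 := \sum_y u y ^+ 2; set S2 := \sum_y v y ^+ 2.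
set S3 := \sum_y u y * v y.
suff -> : \sum_x \sum_y (u x * v y - u y * v x) ^+ 2 =
    (S1 * S2 - S3 ^+ 2) *+ 2 by rewrite pmulrn_lge0 // subr_ge0.
have E x : \sum_y (u x * v y - u y * v x) ^+ 2 =
    u x ^+ 2 * S2 - (u x * v x * S3) *+ 2 + v x ^+ 2 * S1.
  rewrite !mulr_sumr -sumrMnl -sumrB -big_split; apply: eq_bigr => y _ /=.
  by ring.
under eq_bigr do rewrite E.
rewrite big_split sumrB sumrMnl -!mulr_suml /= -/S1 -/S2 -/S3.
by rewrite -expr2 addrAC (mulrC S2) -mulr2n mulrnBl.
Qed.

Lemma norm2_ge0 u : 0 <= norm2 u. Proof. exact: sqrtr_ge0. Qed.

Lemma norm2_comp u (f : Y -> Y) : injective f -> norm2 (u \o f) = norm2 u.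
Proof. by move=> fI; rewrite /norm2 [in RHS](reindex_inj fI). Qed.

(* The sum of [w 0 y_0 * ... * w n.-1 y_(n-1)] over all [y] with
   [parity y = q], see [sum_parity] below. *)
Fixpoint parity_sum n w q : R :=
  if n is m.+1 then \sum_a w 0%N a * parity_sum m (fun i => w i.+1) (toggle q a)
  else (q == finset.set0)%:R.

Lemma eq_parity_sum n w w' q :
  (forall i, w i = w' i) -> parity_sum n w q = parity_sum n w' q.
Proof.
elim: n w w' q => //= n IH w w' q ww.
by apply: eq_bigr => a _; rewrite ww; congr (_ * _); exact: IH.
Qed.

Lemma parity_sum_ge0 n w q :
  (forall i a, 0 <= w i a) -> 0 <= parity_sum n w q.
Proof.
elim: n w q => [|n IH] w q w0 /=; first exact: ler0n.
by apply: sumr_ge0 => a _; rewrite mulr_ge0 ?IH.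
Qed.

(** Each letter flips the parity of the size of the prescribed set, which must end up empty. *)
Lemma parity_sum_odd n w q : odd n != odd #|q| -> parity_sum n w q = 0.
Proof.
elim: n w q => [|n IH] w q /= nq.
  by case: (q =P _) nq => // ->; rewrite cards0.
apply: big1 => a _; rewrite IH ?mulr0 // odd_card_toggle.
by move: nq; case: (odd n); case: (odd #|q|).
Qed.

Lemma sum_parity n w q (y0 : Y) :
  \sum_(y : n.-tuple Y | parity y == q) \prod_(i < n) w i (nth y0 y i) =
  parity_sum n w q.
Proof.
elim: n w q => [|n IH] w q /=.
  rewrite big_mkcond (big_pred1 [tuple]) => [|y]; last by apply/esym/eqP; rewrite tuple0.
  by rewrite big_ord0 parity_nil eq_sym; case: eqP.
have cI : {on [pred y : n.+1.-tuple Y | parity y == q], bijective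
    (fun p : Y * n.-tuple Y => cons_tuple p.1 p.2)}.
  exists (fun y : n.+1.-tuple Y => (thead y, behead_tuple y)).
    by move=> [a y] _ /=; congr pair; apply: val_inj.
  by move=> y _; rewrite [RHS]tuple_eta; apply: val_inj.
rewrite (reindex _ cI) /=.
under eq_bigr => p _ do rewrite big_ord_recl /=.
under eq_bigl => p do rewrite parity_cons.
transitivity (\sum_(p : Y * n.-tuple Y | true && (parity p.2 == toggle q p.1))
    w 0%N p.1 * \prod_(i < n) w i.+1 (nth y0 p.2 i)).
  apply: eq_bigl => p; apply/eqP/eqP => [<- | ->]; last exact: toggleK.
  exact/esym/toggleK.
rewrite -(pair_big_dep xpredT (fun a (y : n.-tuple Y) => parity y == toggle q a)
  (fun a (y : n.-tuple Y) => w 0%N a * \prod_(i < n) w i.+1 (nth y0 y i))) /=.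
by apply: eq_bigr => a _; rewrite -mulr_sumr (IH (fun i => w i.+1)).
Qed.

(* A letter [a] of odd multiplicity occurs at some place [k], which is deleted. *)
Lemma parity_sum_pull n w q a : (forall i a, 0 <= w i a) -> a \in q ->
  parity_sum n w q <=
  \sum_(k < n) w k a * parity_sum n.-1 (fun i => w (bump k i)) (toggle q a).
Proof.
elim: n w q => [|n IH] w q w0 aq.
  by rewrite big_ord0 /=; case: eqP aq => // ->; rewrite inE.
(* Words starting with [a] give the term [k = 0]; after any other first letter [b], [a] still lies
   in [toggle q b]. *)
rewrite big_ord_recl /= (bigD1 a) //=.
apply: lerD => //.
apply: (@le_trans _ _ (\sum_(b | b != a) w 0%N b * (\sum_(k < n) w k.+1 a *
   parity_sum n.-1 (fun i => w (bump k i).+1) (toggle (toggle q b) a)))).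
  apply: ler_sum => b ba; apply: ler_wpM2l => //; apply: IH => //.
  by rewrite inE aq eq_sym (negbTE ba).
(* Restoring the nonnegative term [b = a] completes the sum over first letters. *)
apply: (@le_trans _ _ (\sum_b w 0%N b * (\sum_(k < n) w k.+1 a *
   parity_sum n.-1 (fun i => w (bump k i).+1) (toggle (toggle q b) a)))).
  rewrite [leRHS](bigD1 a) //= lerDr mulr_ge0 //; apply: sumr_ge0 => k _.
  by rewrite mulr_ge0 ?parity_sum_ge0.
under [leLHS]eq_bigr => b _ do rewrite mulr_sumr.
rewrite exchange_big; apply: ler_sum => k _ /=.
case: n k {IH} => [[]//|n] k /=; rewrite mulr_sumr; apply: ler_sum => b _.
rewrite mulrCA toggleC /bump leq0n add1n.
rewrite [in leRHS](@eq_parity_sum _ _ (fun i => w (bump k i).+1)) // => i.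
by rewrite ltnS -addnS.
Qed.

Lemma parity_sum_le t w q : (forall i a, 0 <= w i a) ->
  parity_sum (2 * t) w q <= ((2 * t - 1)`!!)%:R * \prod_(i < 2 * t) norm2 (w i).
Proof.
elim: t w q => [|t IH] w q w0; first by rewrite big_ord0 mulr1 /= lern1 leq_b1.
have [oq | oq] := boolP (odd #|q|).
  rewrite parity_sum_odd; last by rewrite mul2n odd_double oq.
  by rewrite mulr_ge0 // prodr_ge0 // => i _; exact: norm2_ge0.
have [f fI fq] := exists_toggle_matching oq.
rewrite mulnS; set n := (2 * t)%N in IH *.
(* For [t = 0] the truncated [n - 1] is 0, and [0!! = 1]. *)
have E : ((2 + n - 1)`!! = n.+1 * (n - 1)`!!)%N.
  by rewrite /n; case: (t) => // t'; rewrite mulnS.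
rewrite E [leLHS]/=.
apply: (@le_trans _ _ (\sum_(k < n.+1) \sum_b w 0%N b * w k.+1 (f b) *
    (((n - 1)`!!)%:R * \prod_(i < n) norm2 (w (bump k i).+1)))).
  rewrite exchange_big; apply: ler_sum => b _ /=.
  apply: le_trans (ler_wpM2l (w0 0%N b) (@parity_sum_pull n.+1 (fun i => w i.+1)
    _ (f b) (fun i => w0 i.+1) (fq b))) _.
  rewrite mulr_sumr; apply: ler_sum => k _; rewrite -mulrA.
  by do 2![apply: ler_wpM2l => //]; apply: IH.
under [leLHS]eq_bigr => k _ do rewrite -mulr_suml.
rewrite [leRHS](_ : _ = \sum_(k < n.+1) (((n - 1)`!!)%:R *
    \prod_(i < n.+2) norm2 (w i))); last first.
  by rewrite sumr_const card_ord natrM -mulrA mulr_natl.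
apply: ler_sum => k _; rewrite big_ord_recl /= mulrCA.
apply: ler_wpM2l => //.
rewrite (bigD1_ord k) //= mulrA; apply: ler_wpM2r.
  by apply: prodr_ge0 => i _; exact: norm2_ge0.
by rewrite -(norm2_comp (w k.+1) fI); exact: sum_mul_norm2.
Qed.

End OneCoordinate.

(** * Induction over the positions *)

Section ManyCoordinates.
Variables (T Y : finType) (y0 : Y).
Implicit Types (C : seq ((T -> Y) * {set Y})) (A : nat -> {set T}).

Definition constrained_tuples m C A : {set m.-tuple T} :=
  [set x : m.-tuple T | [forall i, tnth x i \in A i] &&
     all (fun c => parity (map c.1 x) == c.2) C]%SET.

(** Grouping tuples by the word [y] they spell under [c.1] replaces each [A i] by its fibre over the
    [i]-th letter of [y]. *)
Lemma card_constrained_tuples_cons m c C A :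
  #|constrained_tuples m (c :: C) A| =
  (\sum_(y : m.-tuple Y | parity y == c.2) #|constrained_tuples m C
     (fun i => A i :&: [set x | c.1 x == nth y0 y i])%SET|)%N.
Proof.
rewrite -sum1dep_card (partition_big (map_tuple c.1) (fun y => parity y == c.2)) /=.
  apply: eq_bigr => y yc; rewrite -[RHS]sum1dep_card; apply: eq_bigl => x.
  have -> : [forall i, tnth x i \in A i :&: [set x | c.1 x == nth y0 y i]]%SET =
      [forall i, tnth x i \in A i] && (map_tuple c.1 x == y).
    apply/forallP/andP => [H | [/forallP H /eqP <-] i]; last first.
      by rewrite !inE H /= (nth_map (tnth x i)) ?size_tuple // -tnth_nth.
    split; first by apply/forallP => i; have := H i; rewrite inE => /andP[].
    apply/eqP/eq_from_tnth => i; rewrite tnth_map.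
    by have := H i; rewrite !inE -tnth_nth => /andP[_ /eqP].
  rewrite -!andbA; congr (_ && _); case: (_ =P y) => [e | _]; last by rewrite !andbF.
  by rewrite -(eqP yc) -e eqxx andbT.
by move=> x /and3P[].
Qed.

Lemma card_constrained_tuples_le t C A :
  (forall i, {in A i &, forall x x', all (fun c => c.1 x == c.1 x') C -> x = x'}) ->
  (#|constrained_tuples (2 * t) C A|%:R : R) <=
  ((2 * t - 1)`!! ^ size C)%:R * \prod_(i < 2 * t) Num.sqrt #|A i|%:R.
Proof.
elim: C A => [|c C IH] A AC.
  (* With no coordinate left to separate points, each [A i] met by a tuple is a singleton: at most
     one tuple exists, and then every factor is at least 1. *)
  rewrite mul1r.
  have [-> | [x0]] := set_0Vmem (constrained_tuples (2 * t) [::] A).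
    by rewrite cards0; apply: prodr_ge0 => i _; exact: sqrtr_ge0.
  rewrite inE andbT => /forallP x0A.
  have -> : constrained_tuples (2 * t) [::] A = [set x0]%SET.
    apply/setP => x; rewrite !inE andbT; apply/forallP/eqP => [xA | -> //].
    by apply/eq_from_tnth => i; exact: AC.
  rewrite cards1; apply: (big_ind (fun z : R => 1 <= z)) => // [z z' | i _].
    by move=> *; apply: mulr_ege1.
  rewrite -[leLHS]sqrtr1 ler_sqrt ?ler0n // ler1n card_gt0.
  by apply/set0Pn; exists (tnth x0 i).
rewrite card_constrained_tuples_cons natr_sum.
(* The fibres of [c.1] partition [A i], so [norm2 (w i)] is the square root of [#|A i|]. *)
pose w i a : R := Num.sqrt #|A i :&: [set x | c.1 x == a]|%SET%:R.
apply: (@le_trans _ _ (((2 * t - 1)`!! ^ size C)%:R * parity_sum (2 * t) w c.2)).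
  rewrite -(sum_parity _ _ _ y0) mulr_sumr; apply: ler_sum => y _; apply: IH => i.
  move=> x x'; rewrite !inE => /andP[xA /eqP xy] /andP[x'A /eqP x'y] xx'.
  by apply: AC xA x'A _; rewrite /= xy x'y eqxx.
rewrite /= expnSr natrM -mulrA; apply: ler_wpM2l => //.
apply: le_trans (parity_sum_le _ _ _) _ => [i a|]; first exact: sqrtr_ge0.
rewrite (eq_bigr (fun i : 'I__ => Num.sqrt #|A i|%:R)) // => i _.
congr (Num.sqrt _); rewrite -sum1_card (partition_big c.1 xpredT) //= natr_sum.
apply: eq_bigr => a _; rewrite sqr_sqrtr ?ler0n // -sum1_card.
by congr (_%:R); apply: eq_bigl => x; rewrite !inE.
Qed.

End ManyCoordinates.
End ParitySums.

(** * Encoding keys over a finite alphabet *)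

Section Coordinates.
Variables (Sigma : Type) (c n : nat) (f : 'I_n -> key Sigma c).

(* The [j]-th character of [f k], encoded by the finite set of indices sharing it;
   this keeps the alphabet finite when [Sigma] is an arbitrary type. *)
Definition char_class (j : 'I_c) (k : 'I_n) : {set 'I_n} :=
  [set l | `[< tnth (f l) j = tnth (f k) j >]]%SET.

Lemma char_classP j k l :
  reflect (tnth (f k) j = tnth (f l) j) (char_class j k == char_class j l).
Proof.
apply: (iffP eqP) => [E | E]; last by rewrite /char_class E.
have : k \in char_class j l by rewrite -E inE; apply/asboolP.
by rewrite inE => /asboolP.
Qed.

(** The letters of [p] at position [j], encoded; those carried by no [f l] have no code. *)
Definition char_classes (p : generalized_key Sigma c) j : {set {set 'I_n}} :=
  [set A | [exists l, (A == char_class j l) && `[< p (j, tnth (f l) j) >]]]%SET.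

Lemma parity_char_class m (x : m.-tuple 'I_n) j :
  parity (map (char_class j) x) =
  char_classes (symdiff_keys (map_tuple f x)) j.
Proof.
have H l : (char_class j l \in parity (map (char_class j) x)) =
    `[< symdiff_keys (map_tuple f x) (j, tnth (f l) j) >].
  rewrite symdiff_keysE inE asboolb; congr odd.
  rewrite count_map -sum1_count big_tuple sum1dep_card /=.
  apply: eq_card => i; rewrite !inE tnth_map.
  apply/char_classP/asboolP => [E | [k _ [<- ->]] //].
  by exists j => //; rewrite E.
apply/setP => A; rewrite [RHS]inE; apply/idP/existsP.
  rewrite inE => oA.
  have /mapP[l _ El] : A \in map (char_class j) x.
    by rewrite -has_pred1 has_count; case: count oA.
  by exists l; rewrite -H El eqxx inE -El.
by case=> l /andP[/eqP ->]; rewrite -H.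
Qed.

End Coordinates.

(** * Counting the tuples of keys *)

Local Open Scope classical_set_scope.

Theorem theorem39 (Sigma : Type) (c n t : nat) (S : set (key Sigma c))
    (p : generalized_key Sigma c) :
  (S #= `I_n)%card ->
  (1 <= t)%N ->
  ([set x : (2 * t).-tuple (key Sigma c) |
      (forall i, S (tnth x i)) /\ symdiff_keys x = p]
   #<= `I_(((2 * t - 1)`!! ^ c * n ^ t)%N))%card.
Proof.
rewrite card_eq_sym => /card_bijP[g gB] _.
have nI (k : 'I_n) : (k : nat) \in `I_n by rewrite inE /=.
pose f (k : 'I_n) : key Sigma c := val (g (SigSub (nI k))).
have fI : injective f.
  by move=> k l /val_inj /(bij_inj gB) /(congr1 val) /= /val_inj.
have fS x : S x -> exists k, f k = x.
  move=> Sx; have [h _ hK] := gB.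
  pose y : S := SigSub (mem_set Sx).
  have hn : (val (h y) < n)%N by have := valP (h y); rewrite inE.
  exists (Ordinal hn); rewrite /f; set z := SigSub _.
  by have -> : z = h y; [exact: val_inj | rewrite hK].
(* One parity constraint per position, on tuples of indices of keys. *)
pose C := [seq (char_class f j, char_classes f p j) | j <- enum 'I_c].
pose D := constrained_tuples (2 * t) C (fun=> [set: 'I_n]%SET).
have D_le : (#|D| <= (2 * t - 1)`!! ^ c * n ^ t)%N.
  rewrite -(ler_nat realalg).
  have := @card_constrained_tuples_le realalg _ _ finset.set0 t C
    (fun=> [set: 'I_n]%SET).
  rewrite size_map size_enum_ord cardsT card_ord prodr_const card_ord.
  rewrite exprM sqr_sqrtr ?ler0n // -natrX -natrM; apply.
  (* Keys that agree at every position are equal, so the coordinates separate indices. *)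
  move=> i k l _ _ /allP kl; apply/fI/eq_from_tnth => j.
  apply/char_classP/(kl (char_class f j, _)).
  by apply/mapP; exists j; rewrite ?mem_enum.
apply: (@card_le_trans _ _ _ `I_#|D|); last by rewrite card_le_II.
(* Every solution is the image under [f] of an index tuple in [D]. *)
apply: (@card_le_trans _ _ _ [set map_tuple f (enum_val k) | k in [set: 'I_#|D|]]).
  apply: subset_card_le => x /= [xS xp].
  have /choice[h hx] : forall i, exists k, f k = tnth x i by move=> i; exact: fS.
  have zx : map_tuple f [tuple h i | i < 2 * t] = x.
    by apply/eq_from_tnth => i; rewrite tnth_map tnth_mktuple hx.
  have zD : [tuple h i | i < 2 * t] \in D.
    rewrite inE; apply/andP; split; first by apply/forallP => i; rewrite inE.
    by apply/allP => _ /mapP[j _ ->]; rewrite parity_char_class zx xp.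
  by exists (enum_rank_in zD [tuple h i | i < 2 * t]); rewrite ?enum_rankK_in.
apply: (@card_le_trans _ _ _ [set: 'I_#|D|]); first exact: card_image_le.
by have := @card_II #|D|; rewrite card_eq_le => /andP[].
Qed.
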